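(* Let $\mathbf x^\ast\in\mathcal F$ be a local minimizer of the lifted AC optimal power flow problem for which Assumption (A) stated in the context holds, with radius $R_0>0$ and constant $\underline\sigma>0$. Write $c(\mathbf x):=\sum_{i\in\mathcal G}c_i(p_i^{\mathrm g})$. Assume in addition that $c$ is continuously differentiable on the closed ball $\overline B(\mathbf x^\ast,R_0)$, and let $L_c>0$ be a constant with $\|\nabla c(\mathbf x)\|\le L_c$ for all $\mathbf x\in\overline B(\mathbf x^\ast,R_0)$. Set $\rho_{\min}:=\min\{\rho_{\tilde g},\rho_{\tilde h}\}$. If $$\rho_{\min}>L_c/\underline\sigma,$$ then $(\mathbf x^\ast,\mathbf 0,\mathbf 0)$ is a local minimizer of the lifted elastic problem $$\min_{\mathbf x,\mathbf s^{\tilde g},\mathbf s^{\tilde h}}\ c(\mathbf x)+\rho_{\tilde g}\mathbf 1^\top\log(\mathbf 1+\mathbf s^{\tilde g})+\rho_{\tilde h}\mathbf 1^\top\log(\mathbf 1+\mathbf s^{\tilde h})\quad\text{s.t.}\quad -\mathbf s^{\tilde g}\le\tilde{\mathbf g}(\mathbf x)\le\mathbf s^{\tilde g},\ \tilde{\mathbf h}(\mathbf x)\le\mathbf s^{\tilde h},\ \mathbf s^{\tilde g}\ge\mathbf 0,\ \mathbf s^{\tilde h}\ge\mathbf 0,$$ where the logarithm and the inequalities apply componentwise.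
   Context: Network data. Buses are $\mathcal N_0=\{0,1,\dots,n_b\}$, where bus $0$ is the slack bus; $\mathcal G\subseteq\mathcal N_0$ is the set of generator buses ($n_g=|\mathcal G|$); $\mathcal L\subseteq\mathcal N_0\times\mathcal N_0$ is the set of branches joining distinct buses ($n_\ell=|\mathcal L|$); $\mathcal L_i$ is the set of branches connected to bus $i$. $\mathbf Y=\mathbf G+\mathrm j\mathbf B$ is the bus admittance matrix with entries $Y_{ik}=G_{ik}+\mathrm jB_{ik}$. Given real data: demands $p_i^{\mathrm d},q_i^{\mathrm d}$ ($i\in\mathcal N_0$), generation bounds $\underline p_i^{\mathrm g},\overline p_i^{\mathrm g},\underline q_i^{\mathrm g},\overline q_i^{\mathrm g}$ ($i\in\mathcal G$), voltage bounds $\underline v_i,\overline v_i$ ($i\in\mathcal N_0$), branch limits $\overline S_\ell$ ($\ell\in\mathcal L$), and cost functions $c_i:\mathbb R\to\mathbb R$ ($i\in\mathcal G$). Variables. $\mathbf x=\operatorname{col}(\mathbf v,\boldsymbol\theta,\mathbf p^{\mathrm g},\mathbf q^{\mathrm g},\tilde{\mathbf p}_{\mathcal L},\tilde{\mathbf q}_{\mathcal L})\in\mathbb R^N$ with $N=2n_b+1+2n_g+2n_\ell$: voltage magnitudes $v_i$ ($i\in\mathcal N_0$), angles $\theta_i$ ($i=1,\dots,n_b$; the slack angle is the fixed reference $\theta_0=0$), generations $p_i^{\mathrm g},q_i^{\mathrm g}$ ($i\in\mathcal G$; set to $0$ for $i\notin\mathcal G$), and auxiliary branch flow variables $\tilde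 p_\ell,\tilde q_\ell$ ($\ell\in\mathcal L$). Power flow functions. With $\theta_{ik}=\theta_i-\theta_k$, for a branch $\ell=(i,k)$: $p_\ell(\mathbf v,\boldsymbol\theta)=v_iv_k(G_{ik}\cos\theta_{ik}+B_{ik}\sin\theta_{ik})$ and $q_\ell(\mathbf v,\boldsymbol\theta)=v_iv_k(G_{ik}\sin\theta_{ik}-B_{ik}\cos\theta_{ik})$. The injections at bus $i$ are the sums of outgoing branch flows, $p_i=\sum_{\ell\in\mathcal L_i}p_\ell$, $q_i=\sum_{\ell\in\mathcal L_i}q_\ell$, where each $\ell\in\mathcal L_i$ is written as $\ell=(i,k)$ with $k$ its other endpoint. Constraints. $\tilde{\mathbf g}(\mathbf x)$ collects the residuals $p_i^{\mathrm g}-p_i^{\mathrm d}-p_i(\mathbf v,\boldsymbol\theta)$ and $q_i^{\mathrm g}-q_i^{\mathrm d}-q_i(\mathbf v,\boldsymbol\theta)$ for $i\in\mathcal N_0$, and $\tilde p_\ell-p_\ell(\mathbf v,\boldsymbol\theta)$, $\tilde q_\ell-q_\ell(\mathbf v,\boldsymbol\theta)$ for $\ell\in\mathcal L$. $\tilde{\mathbf h}(\mathbf x)$ collects $\underline p_i^{\mathrm g}-p_i^{\mathrm g}$, $p_i^{\mathrm g}-\overline p_i^{\mathrm g}$, $\underline q_i^{\mathrm g}-q_i^{\mathrm g}$, $q_i^{\mathrm g}-\overline q_i^{\mathrm g}$ ($i\in\mathcal G$), $\underline v_i-v_i$, $v_i-\overline v_i$ ($i\in\mathcal N_0$), and $\tilde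 p_\ell^2+\tilde q_\ell^2-\overline S_\ell^2$ ($\ell\in\mathcal L$). Lifted problem: minimize $\sum_{i\in\mathcal G}c_i(p_i^{\mathrm g})$ over $\mathbf x\in\mathcal F:=\{\mathbf x\in\mathbb R^N:\tilde{\mathbf g}(\mathbf x)=\mathbf 0,\ \tilde{\mathbf h}(\mathbf x)\le\mathbf 0\}$. $\rho_{\tilde g},\rho_{\tilde h}$ are real penalty parameters. $\|\cdot\|$ is the Euclidean norm, $\overline B(\mathbf x,r)$ the closed Euclidean ball. Assumption (A). $\mathbf x^\ast\in\mathcal F$ is a local minimizer of the lifted problem. For $\mathbf x\in\mathcal F$, let $\mathcal A(\mathbf x)=\{k:\tilde h_k(\mathbf x)=0\}$ and let $\mathbf J(\mathbf x)$ be the matrix whose rows are the gradients (transposed) of all components of $\tilde{\mathbf g}$ and of $\tilde h_k$, $k\in\mathcal A(\mathbf x)$, at $\mathbf x$. There exist $R_0>0$ and $\underline\sigma>0$ such that $\sigma_{\min}(\mathbf J(\mathbf x))\ge\underline\sigma$ for all $\mathbf x\in\mathcal F\cap\overline B(\mathbf x^\ast,R_0)$, and such that $R_0\ge\delta$, where $$\delta:=\frac{\underline\sigma}{M},\qquad M:=\kappa\Bigl(\max_{i\in\mathcal N_0}\sum_{\ell=(i,k)\in\mathcal L_i}|Y_{ik}|\Bigr),\qquad \kappa:=10(1+\overline v),\quad \overline v:=\max_{i\in\mathcal N_0}\overline v_i.$$ Here $\sigma_{\min}$ is the smallest singular value in the LICQ (full row rank) sense, $\sigma_{\min}(\mathbf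 J)=\min_{\|\mathbf w\|=1}\|\mathbf J^\top\mathbf w\|$. *)

(* Defs.v *)
From HB Require Import structures.
From mathcomp Require Import all_boot all_order all_algebra.
From mathcomp Require Import all_classical all_reals all_analysis.
From mathcomp Require Import complex.

Set Implicit Arguments.
Unset Strict Implicit.
Unset Printing Implicit Defensive.

Import Order.TTheory GRing.Theory Num.Theory.
Import numFieldNormedType.Exports.

Local Open Scope classical_set_scope.
Local Open Scope ring_scope.

(* The library norm on matrices is the sup norm, hence a separate Euclidean
   one; both induce the library topology. *)
Definition enorm (R : realType) (n : nat) (x : 'cV[R]_n) : R :=
  Num.sqrt (\sum_(i < n) x i 0 ^+ 2).

Definition eclosed_ball (R : realType) (n : nat) (x : 'cV[R]_n) (r : R)
    : set 'cV[R]_n :=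
  [set y | enorm (y - x) <= r].

Definition gradient (R : realType) (n : nat) (f : 'cV[R]_n -> R)
    (x : 'cV[R]_n) : 'cV[R]_n :=
  \col_(j < n) 'D_(delta_mx j 0) f x.

(* Differentiable (in the ambient space) at every point of D, with a gradient
   that is continuous on D. *)
Definition continuously_differentiable_on (R : realType) (n : nat)
    (D : set 'cV[R]_n) (f : 'cV[R]_n -> R) : Prop :=
  (forall x, D x -> differentiable f x) /\
  {within D, continuous (gradient f)}.

(* The infimum is a minimum as soon as m > 0 (compactness of the sphere).
   It is 0 unless J has full row rank m. *)
Definition sigma_min (R : realType) (m n : nat) (J : 'M[R]_(m, n)) : R :=
  inf [set enorm (J^T *m w) | w in [set w : 'cV[R]_m | enorm w = 1]].

Definition local_minimizer (R : realType) (T : topologicalType)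
    (f : T -> R) (D : set T) (x : T) : Prop :=
  D x /\ \forall y \near x, D y -> f x <= f y.

(* Bus 0 is the slack bus.  Generator data and costs are total functions on
   buses, and branch limits total functions on pairs of buses, but only their
   values on [gens] resp. [branches] are used below. *)
Record opf_data (R : realType) (nb : nat) := OPFData {
  gens : {set 'I_nb.+1};
  branches : {set 'I_nb.+1 * 'I_nb.+1};
  branches_neq : forall l, l \in branches -> l.1 != l.2;
  admittance : 'M[R[i]]_nb.+1;
  pdem : 'I_nb.+1 -> R;
  qdem : 'I_nb.+1 -> R;
  pgen_lo : 'I_nb.+1 -> R;
  pgen_hi : 'I_nb.+1 -> R;
  qgen_lo : 'I_nb.+1 -> R;
  qgen_hi : 'I_nb.+1 -> R;
  vmag_lo : 'I_nb.+1 -> R;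
  vmag_hi : 'I_nb.+1 -> R;
  flow_limit : 'I_nb.+1 * 'I_nb.+1 -> R;
  gen_cost : 'I_nb.+1 -> R -> R
}.

Section OPF.
Variables (R : realType) (nb : nat) (P : opf_data R nb).

Local Notation bus := 'I_nb.+1.
Local Notation ng := #|gens P|.
Local Notation nl := #|branches P|.

Definition conductance (i k : bus) : R := complex.Re (admittance P i k).
Definition susceptance (i k : bus) : R := complex.Im (admittance P i k).
Definition abs_admittance (i k : bus) : R :=
  ComplexField.Normc.normc (admittance P i k).

(* All branches having i as an endpoint, in either orientation. *)
Definition branches_at (i : bus) : {set bus * bus} :=
  [set l in branches P | (l.1 == i) || (l.2 == i)].

Definition other_end (i : bus) (l : bus * bus) : bus :=
  if l.1 == i then l.2 else l.1.

(* Blocks: v, theta (buses 1..nb only), p^g, q^g, p~, q~.  A generator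
   (branch) coordinate a stands for the generator bus (branch) enum_val a. *)
Definition xdim : nat := nb.+1 + (nb + (ng + (ng + (nl + nl)))).

Lemma xdimE : xdim = (2 * nb + 1 + 2 * ng + 2 * nl)%N.
Proof. by rewrite /xdim !mul2n -!addnn addn1 !addSn !addnA. Qed.

Implicit Type x : 'cV[R]_xdim.

Definition vmag x (i : bus) : R := usubmx x i 0.

Definition angle x (i : bus) : R :=
  if unlift ord0 i is Some j then usubmx (dsubmx x) j 0 else 0.

Definition pgen_at x (a : 'I_ng) : R := usubmx (dsubmx (dsubmx x)) a 0.

Definition qgen_at x (a : 'I_ng) : R :=
  usubmx (dsubmx (dsubmx (dsubmx x))) a 0.

Definition ptilde x (b : 'I_nl) : R :=
  usubmx (dsubmx (dsubmx (dsubmx (dsubmx x)))) b 0.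

Definition qtilde x (b : 'I_nl) : R :=
  dsubmx (dsubmx (dsubmx (dsubmx (dsubmx x)))) b 0.

(* At most one summand since enum_val is injective, and none if i is not a
   generator bus. *)
Definition pgen x (i : bus) : R := \sum_(a < ng | enum_val a == i) pgen_at x a.
Definition qgen x (i : bus) : R := \sum_(a < ng | enum_val a == i) qgen_at x a.

Definition pflow x (i k : bus) : R :=
  let t := angle x i - angle x k in
  vmag x i * vmag x k * (conductance i k * cos t + susceptance i k * sin t).

Definition qflow x (i k : bus) : R :=
  let t := angle x i - angle x k in
  vmag x i * vmag x k * (conductance i k * sin t - susceptance i k * cos t).

Definition pinj x (i : bus) : R :=
  \sum_(l in branches_at i) pflow x i (other_end i l).

Definition qinj x (i : bus) : R :=
  \sum_(l in branches_at i) qflow x i (other_end i l).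

Definition gdim : nat := nb.+1 + (nb.+1 + (nl + nl)).

Definition geq x : 'cV[R]_gdim :=
  col_mx (\col_i (pgen x i - pdem P i - pinj x i))
 (col_mx (\col_i (qgen x i - qdem P i - qinj x i))
 (col_mx (\col_b (ptilde x b - pflow x (enum_val b).1 (enum_val b).2))
         (\col_b (qtilde x b - qflow x (enum_val b).1 (enum_val b).2)))).

Definition hdim : nat := ng + (ng + (ng + (ng + (nb.+1 + (nb.+1 + nl))))).

Definition hineq x : 'cV[R]_hdim :=
  col_mx (\col_a (pgen_lo P (enum_val a) - pgen x (enum_val a)))
 (col_mx (\col_a (pgen x (enum_val a) - pgen_hi P (enum_val a)))
 (col_mx (\col_a (qgen_lo P (enum_val a) - qgen x (enum_val a)))
 (col_mx (\col_a (qgen x (enum_val a) - qgen_hi P (enum_val a)))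
 (col_mx (\col_i (vmag_lo P i - vmag x i))
 (col_mx (\col_i (vmag x i - vmag_hi P i))
         (\col_b (ptilde x b ^+ 2 + qtilde x b ^+ 2
                  - flow_limit P (enum_val b) ^+ 2))))))).

Definition cost x : R := \sum_(i in gens P) gen_cost P i (pgen x i).

Definition feasible : set 'cV[R]_xdim :=
  [set x | geq x = 0 /\ forall k, hineq x k 0 <= 0].

Definition active x : {set 'I_hdim} := [set k | hineq x k 0 == 0].

Definition active_jacobian x : 'M[R]_(gdim + #|active x|, xdim) :=
  col_mx (\matrix_(k < gdim) (gradient (fun y => geq y k 0) x)^T)
         (\matrix_(a < #|active x|)
            (gradient (fun y => hineq y (enum_val a) 0) x)^T).

(* Starting the iterated max at the slack bus gives the true maximum, also
   for negative values. *)
Definition max_bus (f : bus -> R) : R := \big[Num.max/f ord0]_(i : bus) f i.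

Definition kappa : R := 10 * (1 + max_bus (vmag_hi P)).

Definition Mconst : R :=
  kappa * max_bus (fun i =>
    \sum_(l in branches_at i) abs_admittance i (other_end i l)).

(* Division by zero gives delta = 0 when Mconst = 0. *)
Definition delta (sigma : R) : R := sigma / Mconst.

Definition licq_assumption (xs : 'cV[R]_xdim) (R0 sigma : R) : Prop :=
  [/\ local_minimizer cost feasible xs,
      0 < R0,
      0 < sigma,
      forall x, feasible x -> eclosed_ball xs R0 x ->
        sigma <= sigma_min (active_jacobian x) &
      delta sigma <= R0].

(* Points are (x, s^g, s^h). *)
Local Notation elastic_point :=
  ('cV[R]_xdim * 'cV[R]_gdim * 'cV[R]_hdim)%type.

Definition elastic_cost (rho_g rho_h : R) (z : elastic_point) : R :=
  let x := z.1.1 in let sg := z.1.2 in let sh := z.2 in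
  cost x + rho_g * (\sum_(k < gdim) ln (1 + sg k 0))
         + rho_h * (\sum_(k < hdim) ln (1 + sh k 0)).

Definition elastic_feasible : set elastic_point :=
  [set z : elastic_point |
    let x := z.1.1 in let sg := z.1.2 in let sh := z.2 in
    [/\ forall k, - sg k 0 <= geq x k 0 <= sg k 0,
        forall k, hineq x k 0 <= sh k 0,
        forall k, 0 <= sg k 0 &
        forall k, 0 <= sh k 0]].

End OPF.

(* Main.v *)
(* At a feasible point the full row rank of the active Jacobian gives a Newton
   direction d cancelling the constraint violation V to first order, with
   sigma |d| <= V.  Hence, for tau < sigma and x near the minimizer xs, a point
   y minimizing V(y) + tau |y - x| over a small ball around xs has V(y) = 0:
   otherwise a Newton step would decrease this function.  So y is feasible with
   |y - x| <= V(x) / tau, and c(xs) <= c(y) <= c(x) + (L / tau) V(x) since c is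
   L-Lipschitz.  For tau close enough to sigma the slope rho of rho log(1 + s)
   at 0 exceeds L / tau, so near 0 the penalty dominates (L / tau) V(x). *)
Require Import Defs.
From mathcomp Require Import all_boot all_order all_algebra.
From mathcomp Require Import all_classical all_reals all_analysis.
From mathcomp Require Import ring lra.

Set Implicit Arguments.
Unset Strict Implicit.
Unset Printing Implicit Defensive.

Import Order.TTheory GRing.Theory Num.Theory.
Import numFieldNormedType.Exports.

Local Open Scope classical_set_scope.
Local Open Scope ring_scope.

(** * Euclidean norm and smallest singular value *)

Section Euclidean.
Variable R : realType.

Definition dot n (u v : 'cV[R]_n) : R := \sum_i u i 0 * v i 0.

Implicit Type n : nat.

Lemma dotC n (u v : 'cV[R]_n) : dot u v = dot v u.
Proof. by apply: eq_bigr => i _; rewrite mulrC. Qed.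

Lemma dotDl n (u v w : 'cV[R]_n) : dot (u + v) w = dot u w + dot v w.
Proof. by rewrite -big_split; apply: eq_bigr => i _; rewrite mxE mulrDl. Qed.

Lemma dotZl n a (u v : 'cV[R]_n) : dot (a *: u) v = a * dot u v.
Proof. by rewrite big_distrr; apply: eq_bigr => i _ /=; rewrite mxE mulrA. Qed.

Lemma dotZr n a (u v : 'cV[R]_n) : dot u (a *: v) = a * dot u v.
Proof. by rewrite dotC dotZl dotC. Qed.

Lemma dot_delta n i (v : 'cV[R]_n) : dot (delta_mx i 0) v = v i 0.
Proof.
rewrite /dot (bigD1 i)//= mxE !eqxx mul1r big1 ?addr0// => j /negPf ji.
by rewrite mxE ji mul0r.
Qed.

Lemma mulmx_dot m n (A : 'M[R]_(m, n)) (v : 'cV[R]_n) k :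
  (A *m v) k 0 = dot (row k A)^T v.
Proof. by rewrite mxE; apply: eq_bigr => j _; rewrite !mxE. Qed.

Lemma enorm_ge0 n (u : 'cV[R]_n) : 0 <= enorm u.
Proof. exact: sqrtr_ge0. Qed.

Lemma enorm_sqr n (u : 'cV[R]_n) : enorm u ^+ 2 = dot u u.
Proof.
by rewrite sqr_sqrtr ?sumr_ge0// => i _; rewrite sqr_ge0.
Qed.

Lemma enormZ n a (u : 'cV[R]_n) : enorm (a *: u) = `|a| * enorm u.
Proof.
rewrite -sqrtr_sqr -sqrtrM ?sqr_ge0// big_distrr; congr Num.sqrt.
by apply: eq_bigr => i _ /=; rewrite mxE exprMn.
Qed.

Lemma enorm0 n : enorm (0 : 'cV[R]_n) = 0.
Proof. by rewrite -(scale0r 0) enormZ normr0 mul0r. Qed.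

Lemma enormN n (u : 'cV[R]_n) : enorm (- u) = enorm u.
Proof. by rewrite -scaleN1r enormZ normrN1 mul1r. Qed.

Lemma enorm_distrC n (u v : 'cV[R]_n) : enorm (u - v) = enorm (v - u).
Proof. by rewrite -enormN opprB. Qed.

Lemma coord_le_enorm n (u : 'cV[R]_n) i : `|u i 0| <= enorm u.
Proof.
rewrite -sqrtr_sqr ler_wsqrtr// (bigD1 i)//= lerDl sumr_ge0// => j _.
exact: sqr_ge0.
Qed.

Lemma enorm_eq0 n (u : 'cV[R]_n) : enorm u = 0 -> u = 0.
Proof.
move=> u0; apply/colP => i; rewrite mxE; apply/normr0_eq0/le_anti.
by rewrite normr_ge0 -u0 coord_le_enorm.
Qed.

Lemma norm_le_enorm n (u : 'cV[R]_n) : `|u| <= enorm u.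
Proof.
rewrite [leLHS]/Num.norm/= mx_normrE; apply/bigmax_leP; split.
  exact: enorm_ge0.
by move=> [i j] _ /=; rewrite (ord1 j) coord_le_enorm.
Qed.

(** After squaring, each term [|u i 0| ^+ 2] is at most [|u i 0|] times the whole sum. *)
Lemma enorm_le_sum n (u : 'cV[R]_n) : enorm u <= \sum_i `|u i 0|.
Proof.
rewrite -[leRHS]ger0_norm ?sumr_ge0// -sqrtr_sqr ler_wsqrtr//.
rewrite expr2 big_distrl; apply: ler_sum => i _ /=.
rewrite -normr_id -[_ ^+ 2]ger0_norm ?sqr_ge0// normrX normr_id expr2.
by rewrite ler_wpM2l// (bigD1 i)//= lerDl sumr_ge0.
Qed.

(** Cauchy-Schwarz: with a = |u| and b = |v|, the squared norm of bu + sau', where u' = v and s is 1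
    or -1, equals 2ab(ab + s<u,v>) and is nonnegative. *)
Lemma normr_dot n (u v : 'cV[R]_n) : `|dot u v| <= enorm u * enorm v.
Proof.
have [/enorm_eq0 ->|u0] := eqVneq (enorm u) 0.
  by rewrite -(scale0r 0) dotZl mul0r normr0 enormZ normr0 !mul0r.
have [/enorm_eq0 ->|v0] := eqVneq (enorm v) 0.
  by rewrite -(scale0r 0) dotZr mul0r normr0 enormZ normr0 mul0r mulr0.
have up : 0 < enorm u by rewrite lt0r u0 enorm_ge0.
have vp : 0 < enorm v by rewrite lt0r v0 enorm_ge0.
have key s : 0 <= dot (enorm v *: u + s *: (enorm u *: v))
                      (enorm v *: u + s *: (enorm u *: v)).
  by rewrite -enorm_sqr sqr_ge0.
have pos := mulr_gt0 up vp.
rewrite ler_norml; apply/andP; split.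
- have := key 1; rewrite scale1r !dotDl !dotZl ![dot _ (_ + _)]dotC !dotDl.
  rewrite !dotZl -!enorm_sqr (dotC v u) => h.
  rewrite -subr_ge0 -(pmulr_rge0 _ pos); nra.
- have := key (-1); rewrite scaleN1r !dotDl -!scaleNr !dotZl.
  rewrite ![dot _ (_ + _)]dotC !dotDl !dotZl -!enorm_sqr (dotC v u) => h.
  rewrite -subr_ge0 -(pmulr_rge0 _ pos); nra.
Qed.

Lemma enormD n (u v : 'cV[R]_n) : enorm (u + v) <= enorm u + enorm v.
Proof.
rewrite -(ler_pXn2r (_ : (0 < 2)%N)) ?nnegrE ?addr_ge0 ?enorm_ge0//.
rewrite enorm_sqr dotDl ![dot _ (_ + _)]dotC !dotDl (dotC v u) sqrrD.
rewrite !enorm_sqr; have := le_trans (ler_norm _) (normr_dot u v); lra.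
Qed.

Lemma enorm_continuous n : continuous (@enorm R n).
Proof.
move=> u; apply: continuous_comp; last exact: sqrt_continuous.
apply: (@cvg_big _ _ _ _ _ _ _ (nbhs u)) => [|i _]; first exact: add_continuous.
apply: (continuous_comp (f := fun v : 'cV[R]_n => v i 0)
                        (g := fun z => z ^+ 2)).
  exact: coord_continuous.
exact: exprn_continuous.
Qed.

(** With [eclosed_ball_nbhs], this makes Euclidean balls a neighbourhood basis for the sup-norm
    topology of the library. *)
Lemma near_enorm n (x : 'cV[R]_n) r : 0 < r ->
  \forall y \near x, enorm (y - x) < r.
Proof.
move=> r0; have c : {for x, continuous (fun y : 'cV[R]_n => enorm (y - x))}.
  apply: continuous_comp; last exact: enorm_continuous.
  by apply: continuousB => //; exact: cst_continuous.
by apply: (cvgr_lt _ c); rewrite subrr enorm0.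
Qed.

Lemma eclosed_ball_nbhs n (x : 'cV[R]_n) (A : set 'cV[R]_n) : nbhs x A ->
  exists2 r, 0 < r & eclosed_ball x r `<=` A.
Proof.
move=> /nbhs_ballP [e /= e0 eA]; exists (e / 2); first by rewrite divr_gt0.
move=> y /= xy; apply: eA; rewrite -ball_normE /= distrC.
apply: le_lt_trans (norm_le_enorm _) _; apply: le_lt_trans xy _.
by rewrite ltr_pdivrMr// ltr_pMr// ltr1n.
Qed.

(** Compactness of the ball, carried over to row vectors by transposition, where the extreme value
    theorem [EVT_min_rV] applies. *)
Lemma eclosed_ball_EVT_min n (f : 'cV[R]_n -> R) (x : 'cV[R]_n) (r : R) :
  0 <= r ->
  (forall y, eclosed_ball x r y -> {for y, continuous f}) ->
  exists2 y, eclosed_ball x r y & forall z, eclosed_ball x r z -> f y <= f z.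
Proof.
move=> r0 fc.
pose A : set 'rV[R]_n := [set u | eclosed_ball x r u^T].
have tc : continuous (fun u : 'rV[R]_n => u^T).
  move=> u B [Q nQ QB]; exists (fun i j => Q j i) => [i j|w wQ].
    by have := nQ j i; rewrite mxE.
  by apply: QB => i j; rewrite mxE; exact: wQ.
have nc : continuous (fun u : 'rV[R]_n => enorm (u^T - x)).
  move=> u; apply: continuous_comp; last exact: enorm_continuous.
  by apply: continuousB; [exact: tc|exact: cst_continuous].
have cA : compact A.
  apply: bounded_closed_compact.
    exists (enorm x + r); split; first exact: num_real.
    move=> M xrM u /= Au; apply: le_trans (ltW xrM).
    have uE : `|u| <= enorm u^T.
      rewrite [leLHS]/Num.norm/= mx_normrE.
      apply/bigmax_leP; split=> [|[i j] _].
        exact: enorm_ge0.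
      by rewrite /= (ord1 i); have := coord_le_enorm u^T j; rewrite mxE.
    apply: le_trans uE _; rewrite -[u^T](subrK x).
    by apply: le_trans (enormD _ _) _; rewrite addrC lerD2l.
  have /continuous_closedP/(_ _ (@closed_le _ r)) := nc.
  by congr closed; apply/seteqP; split.
have [||u uA umin] := @EVT_min_rV R n (fun u => f u^T) A _ cA.
- by exists x^T; rewrite /A /eclosed_ball /= trmxK subrr enorm0.
- apply: continuous_in_subspaceT => u /set_mem uA.
  by apply: continuous_comp; [exact: tc|exact: fc].
exists u^T; first exact: set_mem uA.
by move=> z xz; rewrite -[z]trmxK; apply: umin; rewrite inE /A /= trmxK.
Qed.

(** The least-norm solution d = J^T u with u = (J J^T)^-1 w works: |d|^2 = <u,w> <= |u||w|, and s|u|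
    <= |J^T u| = |d|. *)
Lemma sigma_min_surjective m n (J : 'M[R]_(m, n)) (s : R) (w : 'cV[R]_m) :
  0 < s -> s <= sigma_min J ->
  exists2 d : 'cV[R]_n, J *m d = w & s * enorm d <= enorm w.
Proof.
move=> s0 sJ.
(* The infimum over the unit sphere extends to every v by scaling. *)
have low (v : 'cV[R]_m) : s * enorm v <= enorm (J^T *m v).
  have [/enorm_eq0 ->|v0] := eqVneq (enorm v) 0.
    by rewrite enorm0 mulr0 enorm_ge0.
  have vp : 0 < enorm v by rewrite lt0r v0 enorm_ge0.
  rewrite mulrC -ler_pdivlMl//; apply: le_trans sJ _.
  rewrite -[X in X * _]ger0_norm ?invr_ge0 ?enorm_ge0// -enormZ scalemxAr.
  apply: ge_inf; first by exists 0 => _ [z _ <-]; exact: enorm_ge0.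
  exists ((enorm v)^-1 *: v) => //=.
  by rewrite enormZ ger0_norm ?invr_ge0 ?enorm_ge0// mulVf.
have dotJ (u v : 'cV[R]_m) : dot (J^T *m u) (J^T *m v) = dot u (J *m J^T *m v).
  rewrite -mulmxA; transitivity (((J^T *m u)^T *m (J^T *m v)) 0 0).
    by rewrite mxE; apply: eq_bigr => i _; rewrite [in RHS]mxE.
  rewrite trmx_mul trmxK -mulmxA mxE; apply: eq_bigr => i _.
  by rewrite [u^T _ _]mxE.
(* If J J^T v = 0 then |J^T v|^2 = <v, J J^T v> = 0, and [low] forces v = 0. *)
have JJ : J *m J^T \in unitmx.
  rewrite -unitmx_tr -row_free_unit -kermx_eq0; apply/eqP/row_matrixP => i.
  set v := row i _; rewrite row0.
  have kv : J *m J^T *m v^T = 0.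
    rewrite -[X in X *m _]trmxK -trmx_mul.
    by rewrite (sub_kermxP (row_sub i _)) trmx0.
  have : enorm (J^T *m v^T) = 0.
    apply/eqP; rewrite -sqrf_eq0 enorm_sqr dotJ kv.
    by rewrite -(scale0r 0) dotZr mul0r.
  move=> e; have := low v^T; rewrite e pmulr_rle0// => v0.
  have /enorm_eq0 /(congr1 trmx) : enorm v^T = 0.
    by apply/le_anti; rewrite v0 enorm_ge0.
  by rewrite trmxK trmx0.
pose u := invmx (J *m J^T) *m w.
exists (J^T *m u); first by rewrite mulmxA mulKVmx.
have [/enorm_eq0 ->|d0] := eqVneq (enorm (J^T *m u)) 0.
  by rewrite enorm0 mulr0 enorm_ge0.
have dp : 0 < enorm (J^T *m u) by rewrite lt0r d0 enorm_ge0.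
rewrite -(ler_pM2r dp) -mulrA -expr2 enorm_sqr dotJ mulKVmx//.
apply: le_trans (ler_wpM2l (ltW s0) (le_trans (ler_norm _) (normr_dot u w))) _.
by rewrite mulrA mulrC ler_wpM2l ?enorm_ge0.
Qed.

End Euclidean.

(** * Mean value estimate on a ball and a lower bound for the logarithm *)

Section Lipschitz.
Variable R : realType.

Lemma derive_gradient n (f : 'cV[R]_n -> R) (x v : 'cV[R]_n) :
  differentiable f x -> 'D_v f x = dot (gradient f x) v.
Proof.
move=> fx; have {1}-> : v = \sum_i v i 0 *: delta_mx i 0.
  by rewrite {1}[v]matrix_sum_delta; apply: eq_bigr => i _; rewrite big_ord1.
rewrite deriveE// linear_sum; apply: eq_bigr => i _.
by rewrite linearZ mxE deriveE//= mulrC.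
Qed.

Lemma eclosed_ball_convex n (x0 x y : 'cV[R]_n) (r t : R) : 0 <= t <= 1 ->
  eclosed_ball x0 r x -> eclosed_ball x0 r y ->
  eclosed_ball x0 r (y + t *: (x - y)).
Proof.
move=> /andP[t0 t1] xr yr; rewrite /eclosed_ball/=.
have -> : y + t *: (x - y) - x0 = t *: (x - x0) + (1 - t) *: (y - x0).
  by apply/colP => i; rewrite !mxE; ring.
apply: le_trans (enormD _ _) _; rewrite !enormZ !ger0_norm ?subr_ge0//.
move: xr yr; rewrite /eclosed_ball/=; nra.
Qed.

(** Mean value theorem along the segment from y to x, which stays in the ball by convexity, followed
    by Cauchy-Schwarz. *)
Lemma lipschitz_eclosed_ball n (f : 'cV[R]_n -> R) (x0 : 'cV[R]_n) (r L : R) :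
  (forall x, eclosed_ball x0 r x -> differentiable f x) ->
  (forall x, eclosed_ball x0 r x -> enorm (gradient f x) <= L) ->
  forall x y, eclosed_ball x0 r x -> eclosed_ball x0 r y ->
    f x - f y <= L * enorm (x - y).
Proof.
move=> fd fL x y xr yr; pose c t := y + t *: (x - y).
have cB (t : R) : t \in `[0, 1] -> eclosed_ball x0 r (c t).
  by rewrite in_itv => t01; exact: eclosed_ball_convex.
(* The difference quotient of [f \o c] at t is that of [f] at [c t] in the direction x - y, so the
   derivative along the segment is a directional derivative. *)
have quotE (t : R) :
    (fun h : R => h^-1 *: (((f \o c) \o shift t) (h *: 1) - (f \o c) t)) =
    (fun h : R => h^-1 *: ((f \o shift (c t)) (h *: (x - y)) - f (c t))).
  apply/funext => h /=; congr (_ *: (f _ - _)).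
  by rewrite /c -[h *: 1]/(h * 1) mulr1 scalerDl addrCA.
have dfc (t : R) : t \in `[0, 1] ->
    is_derive t 1 (f \o c) (dot (gradient f (c t)) (x - y)).
  move=> t01; have dt := fd _ (cB _ t01); apply: DeriveDef.
    by rewrite /derivable quotE; exact: diff_derivable.
  by rewrite /derive quotE -derive_gradient.
have dfc' (t : R) : t \in `]0, 1[ ->
    is_derive t 1 (f \o c) (dot (gradient f (c t)) (x - y)).
  by move=> t01; apply: dfc; exact: subset_itv_oo_cc t01.
have [|t t01] := MVT_segment ler01 dfc'.
  by apply: derivable_within_continuous => t /dfc [].
rewrite /= /c scale0r addr0 scale1r [y + _]addrC subrK subr0 mulr1 => ->.
apply: le_trans (ler_norm _) (le_trans (normr_dot _ _) _).
by rewrite ler_wpM2r ?enorm_ge0//; exact/fL/cB.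
Qed.

(** This is ln(1 + t) <= t at t = 1/(1 + s) - 1, where the left side is -ln(1 + s). *)
Lemma ln1D_ge (s : R) : 0 <= s -> s / (1 + s) <= ln (1 + s).
Proof.
move=> s0; have s1 : 0 < 1 + s by lra.
have : ln (1 + ((1 + s)^-1 - 1)) <= (1 + s)^-1 - 1.
  by apply: le_ln1Dx; have : 0 < (1 + s)^-1; [rewrite invr_gt0|lra].
rewrite addrC subrK lnV ?posrE//.
have -> : s / (1 + s) = 1 - (1 + s)^-1 by field; rewrite gt_eqF.
lra.
Qed.

End Lipschitz.

(** * Strict differentiability *)

Section StrictDerivative.
Variables (R : realType) (n : nat).
Implicit Types (f g : 'cV[R]_n -> R) (x G H : 'cV[R]_n).

(** Both points move near [x]. A Newton step compares y with y + d, neither of which is the base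
    point where the Jacobian is taken, so ordinary differentiability there would not suffice. *)
Definition strict_derivative f x G := forall e, 0 < e ->
  \forall z \near (x, x),
    `|f z.1 - f z.2 - dot G (z.1 - z.2)| <= e * enorm (z.1 - z.2).

Definition strictly_differentiable f x := exists G, strict_derivative f x G.

Lemma strict_derivative_lip f x G : strict_derivative f x G ->
  \forall z \near (x, x),
    `|f z.1 - f z.2| <= (1 + enorm G) * enorm (z.1 - z.2).
Proof.
move=> /(_ 1 ltr01); apply: filterS => z fz.
have := ler_normD (f z.1 - f z.2 - dot G (z.1 - z.2)) (dot G (z.1 - z.2)).
by rewrite subrK; have := normr_dot G (z.1 - z.2); lra.
Qed.

Lemma strict_derivative_continuous f x G :
  strict_derivative f x G -> {for x, continuous f}.
Proof.
move=> /strict_derivative_lip /= [[A B] /= [xA xB] AB].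
have G0 : 0 < 1 + enorm G by rewrite ltr_pwDl ?enorm_ge0.
apply/(@cvgrPdist_le _ _ _ (nbhs x)) => e e0.
have := near_enorm x (divr_gt0 e0 G0).
apply: filterS2 xA => a Aa ae.
have /= := AB (a, x) (conj Aa (nbhs_singleton xB)).
rewrite distrC => /le_trans; apply.
by rewrite mulrC -ler_pdivlMr// ltW.
Qed.

Lemma strict_derivativeD f g x G H : strict_derivative f x G ->
  strict_derivative g x H -> strict_derivative (fun y => f y + g y) x (G + H).
Proof.
move=> fG gH e e0; have e2 : 0 < e / 2 by rewrite divr_gt0.
apply: filterS2 (fG _ e2) (gH _ e2) => z fz gz /=.
rewrite dotDl; set a := f _ - _ - _ in fz; set b := g _ - _ - _ in gz.
have -> : f z.1 + g z.1 - (f z.2 + g z.2) -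
          (dot G (z.1 - z.2) + dot H (z.1 - z.2)) = a + b.
  by rewrite /a /b; ring.
apply: le_trans (ler_normD _ _) _; lra.
Qed.

(* The chain rule with an outer C^1 function of one variable, which by the mean
   value theorem is strictly differentiable. *)
Lemma strict_derivative_comp (phi dphi : R -> R) f x G :
  (forall t : R, is_derive t 1 phi (dphi t)) -> continuous dphi ->
  strict_derivative f x G ->
  strict_derivative (phi \o f) x (dphi (f x) *: G).
Proof.
move=> phi' dphic fG e e0.
have fc := strict_derivative_continuous fG.
have phic : continuous phi.
  move=> t; apply: differentiable_continuous; apply/derivable1_diffP.
  by have [] := phi' t.
(* The intermediate point lies between a and b, hence is no farther from [f x] than the farther
   endpoint. *)
have mvt a b : exists2 c, `|c - f x| <= Num.max `|a - f x| `|b - f x| &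
    phi a - phi b = dphi c * (a - b).
  wlog ba : a b / b <= a.
    move=> wl; have [/wl//|/ltW/wl [c cx e1]] := leP b a.
    by exists c; [rewrite maxC|rewrite -opprB e1 -mulrN opprB].
  have [c cab ->] :=
    MVT_segment ba (fun t _ => phi' t) (continuous_subspaceT phic).
  exists c => //; move: cab; rewrite in_itv/= => /andP[bc ca].
  rewrite le_max; apply/orP; have [xc|cx] := leP (f x) c; [left|right].
    by rewrite !ger0_norm ?lerB ?subr_ge0//; exact: le_trans xc ca.
  rewrite ![`|_ - f x|]distrC !ger0_norm ?lerB// subr_ge0 ?ltW//.
  exact: le_lt_trans bc cx.
(* The error is split as phi'(c)(u - v) - (phi'(f x) - phi'(c))v, with u the increment of [f] and v
   its linearization; [e2] controls the first term and [e1] the second, each contributing e/2. *)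
pose e1 := e / (2 * (1 + enorm G)).
have G0 : 0 < 1 + enorm G by rewrite ltr_pwDl ?enorm_ge0.
have e10 : 0 < e1 by rewrite divr_gt0// mulr_gt0.
have D0 : 0 < `|dphi (f x)| + e1 by rewrite ltr_wpDl.
pose e2 := e / (2 * (`|dphi (f x)| + e1)).
have e20 : 0 < e2 by rewrite divr_gt0// mulr_gt0.
have /cvgrPdist_le /(_ _ e10) /nbhs_ballP [r /= r0 fxr] := dphic (f x).
have near_f : \forall a \near x, `|f a - f x| < r.
  have /(@cvgrPdist_lt _ _ _ (nbhs x)) /(_ _ r0) := fc.
  by apply: filterS => a; rewrite distrC.
have near_ff : \forall z \near (x, x), `|f z.1 - f x| < r /\ `|f z.2 - f x| < r.
  by exists ([set a | `|f a - f x| < r], [set a | `|f a - f x| < r]).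
apply: filterS2 near_ff (fG _ e20) => z [z1r z2r] fz /=.
have [c cx ->] := mvt (f z.1) (f z.2).
have cr : `|dphi (f x) - dphi c| <= e1.
  apply: fxr; rewrite -ball_normE /= distrC; apply: le_lt_trans cx _.
  by rewrite gt_max z1r z2r.
have cD : `|dphi c| <= `|dphi (f x)| + e1.
  rewrite -[dphi c](subKr (dphi (f x))); apply: le_trans (ler_normB _ _) _.
  by rewrite lerD2l.
rewrite dotZl; set u := f _ - f _ in fz *; set v := dot _ _ in fz *.
have -> : dphi c * u - dphi (f x) * v =
          dphi c * (u - v) - (dphi (f x) - dphi c) * v by ring.
apply: le_trans (ler_normB _ _) _; rewrite !normrM.
set N := enorm _ in fz *; have N0 : 0 <= N := enorm_ge0 _.
have vN : `|v| <= (1 + enorm G) * N.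
  apply: le_trans (normr_dot _ _) _; rewrite -/N ler_wpM2r//; lra.
have E2 : (`|dphi (f x)| + e1) * e2 = e / 2.
  by rewrite /e2; field; rewrite gt_eqF.
have E1 : e1 * (1 + enorm G) = e / 2 by rewrite /e1; field; rewrite gt_eqF.
have -> : e * N = (`|dphi (f x)| + e1) * (e2 * N) + e1 * ((1 + enorm G) * N).
  by rewrite [_ * (e2 * _)]mulrA E2 [e1 * _]mulrA E1 -mulrDl -splitr.
by apply: lerD; apply: ler_pM.
Qed.

Lemma derive_strict_derivative f x G v :
  strict_derivative f x G -> 'D_v f x = dot G v.
Proof.
move=> fG; apply: cvg_lim => //; apply/cvgrPdist_le => e e0.
have v0 : 0 < 1 + enorm v by rewrite ltr_pwDl ?enorm_ge0.
(* The quotient error is at most this constant times |v|, hence at most e; the added 1 covers v =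
   0. *)
have e1 : 0 < e / (1 + enorm v) by rewrite divr_gt0.
have [[A B] /= [xA xB] AB] := fG _ e1.
have hx : (fun h : R => h *: v + x) @ 0^' --> x.
  have c : {for 0, continuous (fun h : R => h *: v + x)}.
    apply: continuousD; last exact: cst_continuous.
    by apply: scalel_continuous.
  by move=> S xS; apply/nbhs_dnbhs/c; rewrite /= scale0r add0r.
have := hx _ xA.
rewrite near_simpl => hA; near=> h.
have h0 : h != 0 by near: h; exact: nbhs_dnbhs_neq.
have hAh : A (h *: v + x) by near: h.
(* Freezing the second point at [x] turns the strict estimate into the ordinary one. *)
have /= := AB (h *: v + x, x) (conj hAh (nbhs_singleton xB)).
rewrite addrK enormZ dotZr => le1; rewrite distrC.
have -> : h^-1 *: (f (h *: v + x) - f x) - dot G v =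
  h^-1 * (f (h *: v + x) - f x - h * dot G v).
  by rewrite mulrBr mulKf.
rewrite normrM normfV ler_pdivrMl ?normr_gt0//; apply: le_trans le1 _.
rewrite mulrCA ler_wpM2l// -mulrA ler_piMr ?(ltW e0)//.
by rewrite ler_pdivrMl// mulr1 lerDr.
Unshelve. all: by end_near. Qed.

(** Identifies the strict derivative with the vector of partial derivatives that forms a row of the
    Jacobian. *)
Lemma gradient_strict_derivative f x G :
  strict_derivative f x G -> gradient f x = G.
Proof.
move=> fG; apply/colP => i.
by rewrite mxE (derive_strict_derivative _ fG) dotC dot_delta.
Qed.

Lemma strictly_differentiable_gradient f x :
  strictly_differentiable f x -> strict_derivative f x (gradient f x).
Proof. by case=> G fG; rewrite (gradient_strict_derivative fG). Qed.

Lemma strictly_differentiable_continuous f x :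
  strictly_differentiable f x -> {for x, continuous f}.
Proof. by case=> G; exact: strict_derivative_continuous. Qed.

(** * Calculus rules for strict differentiability *)

Lemma strictly_differentiable_coord i x :
  strictly_differentiable (fun y : 'cV[R]_n => y i 0) x.
Proof.
exists (delta_mx i 0) => e e0; apply: (@filterE _ (nbhs (x, x))) => z.
by rewrite dot_delta !mxE subrr normr0 mulr_ge0 ?enorm_ge0// ltW.
Qed.

Lemma strictly_differentiable_cst c x :
  strictly_differentiable (fun=> c : R) x.
Proof.
exists 0 => e e0; apply: (@filterE _ (nbhs (x, x))) => z.
rewrite -(scale0r 0) dotZl mul0r !subrr normr0 mulr_ge0 ?enorm_ge0//.
exact: ltW.
Qed.

Lemma strictly_differentiableD f g x : strictly_differentiable f x ->
  strictly_differentiable g x -> strictly_differentiable (fun y => f y + g y) x.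
Proof.
by move=> [G fG] [H gH]; exists (G + H); exact: strict_derivativeD.
Qed.

Lemma strictly_differentiable_comp (phi dphi : R -> R) f x :
  (forall t : R, is_derive t 1 phi (dphi t)) -> continuous dphi ->
  strictly_differentiable f x -> strictly_differentiable (phi \o f) x.
Proof.
move=> phi' dphic [G fG]; exists (dphi (f x) *: G).
exact: strict_derivative_comp.
Qed.

Lemma strictly_differentiableZ c f x : strictly_differentiable f x ->
  strictly_differentiable (fun y => c * f y) x.
Proof.
apply: (strictly_differentiable_comp (phi := *%R c) (dphi := fun=> c)).
  move=> t; apply: is_derive_eq.
  by rewrite /GRing.scale /= mulr1.
exact: cst_continuous.
Qed.

Lemma strictly_differentiableB f g x : strictly_differentiable f x ->
  strictly_differentiable g x -> strictly_differentiable (fun y => f y - g y) x.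
Proof.
move=> fx /(strictly_differentiableZ (-1)) gx.
have -> : (fun y => f y - g y) = (fun y => f y + -1 * g y).
  by apply/funext => y; rewrite mulN1r.
exact: strictly_differentiableD.
Qed.

Lemma strictly_differentiable_sqr f x : strictly_differentiable f x ->
  strictly_differentiable (fun y => f y ^+ 2) x.
Proof.
apply: (strictly_differentiable_comp (phi := fun t => t ^+ 2)
         (dphi := fun t => 2 * t)).
  move=> t; apply: is_derive_eq.
  by rewrite /GRing.scale /= mulr1 mulr_natl.
by move=> t; apply: mulrl_continuous.
Qed.

(** Polarization, fg = ((f + g)^2 - (f - g)^2)/4, reduces products to squares, which the
    one-variable chain rule handles. *)
Lemma strictly_differentiableM f g x : strictly_differentiable f x ->
  strictly_differentiable g x -> strictly_differentiable (fun y => f y * g y) x.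
Proof.
move=> fx gx.
have -> : (fun y => f y * g y) =
    (fun y => 4^-1 * ((f y + g y) ^+ 2 - (f y - g y) ^+ 2)).
  by apply/funext => y; field.
apply/strictly_differentiableZ/strictly_differentiableB;
  apply: strictly_differentiable_sqr.
  exact: strictly_differentiableD.
exact: strictly_differentiableB.
Qed.

Lemma strictly_differentiable_cos f x : strictly_differentiable f x ->
  strictly_differentiable (fun y => cos (f y)) x.
Proof.
apply: (strictly_differentiable_comp (phi := cos) (dphi := fun t => - sin t)).
by move=> t; apply: continuousN; exact: continuous_sin.
Qed.

Lemma strictly_differentiable_sin f x : strictly_differentiable f x ->
  strictly_differentiable (fun y => sin (f y)) x.
Proof.
by apply: (strictly_differentiable_comp (phi := sin) (dphi := cos));
  exact: continuous_cos.
Qed.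

Lemma strictly_differentiable_sum (I : Type) (r : seq I) (p : pred I)
    (F : I -> 'cV[R]_n -> R) x :
  (forall i, strictly_differentiable (F i) x) ->
  strictly_differentiable (fun y => \sum_(i <- r | p i) F i y) x.
Proof.
move=> Fx; elim: r => [|i r IH].
  have -> : (fun y => \sum_(i <- [::] | p i) F i y) = (fun=> 0).
    by apply/funext => y; rewrite big_nil.
  exact: strictly_differentiable_cst.
have -> : (fun y => \sum_(j <- i :: r | p j) F j y) =
    if p i then (fun y => F i y + \sum_(j <- r | p j) F j y)
    else (fun y => \sum_(j <- r | p j) F j y).
  by apply/funext => y; rewrite big_cons; case: ifP.
by case: ifP => // _; exact: strictly_differentiableD.
Qed.

End StrictDerivative.

(** * Error bound and exact penalty *)

Section ExactPenalty.
Variables (R : realType) (n p q : nat).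
Variables (g : 'cV[R]_n -> 'cV[R]_p) (h : 'cV[R]_n -> 'cV[R]_q).
Hypothesis g_sd : forall k x, strictly_differentiable (fun y => g y k 0) x.
Hypothesis h_sd : forall k x, strictly_differentiable (fun y => h y k 0) x.

(** For [g], [h] the power flow constraints, this and the definitions of active set, Jacobian and
    elastic feasible set below are convertible with the concrete ones, so the abstract result
    applies directly. *)
Definition feasible_set : set 'cV[R]_n :=
  [set x | g x = 0 /\ forall k, h x k 0 <= 0].

Definition active_set x : {set 'I_q} := [set k | h x k 0 == 0].

Definition constraint_jacobian x : 'M[R]_(p + #|active_set x|, n) :=
  col_mx (\matrix_(k < p) (gradient (fun y => g y k 0) x)^T)
         (\matrix_(a < #|active_set x|)
            (gradient (fun y => h y (enum_val a) 0) x)^T).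

(** The l1 violation: at an elastic feasible point it is bounded by the sum of all slacks. *)
Definition violation x : R :=
  \sum_k `|g x k 0| + \sum_k Num.max (h x k 0) 0.

Lemma violation_ge0 x : 0 <= violation x.
Proof.
by rewrite addr_ge0// sumr_ge0// => k _; rewrite le_max lexx orbT.
Qed.

Lemma violation_eq0 x : violation x = 0 <-> feasible_set x.
Proof.
have max0 k : 0 <= Num.max (h x k 0) 0 by rewrite le_max lexx orbT.
split=> [/eqP|[gx hx]]; last first.
  rewrite /violation gx !big1 ?addr0// => k _; last by rewrite mxE normr0.
  exact/max_idPr.
rewrite paddr_eq0 ?sumr_ge0// => /andP[/eqP g0 /eqP h0]; split.
  apply/colP => k; rewrite mxE; apply/normr0_eq0.
  exact: (psumr_eq0P (fun i _ => normr_ge0 (g x i 0)) g0).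
move=> k; apply/max_idPr.
exact: (psumr_eq0P (fun i _ => max0 i) h0).
Qed.

Lemma violation_continuous : continuous violation.
Proof.
move=> x; apply: (@cvgD _ _ _ (nbhs x)).
  apply: (@cvg_big _ _ _ _ _ _ _ (nbhs x)) => [|k _].
    exact: add_continuous.
  apply: (@cvg_norm _ _ _ (nbhs x)).
  exact: strictly_differentiable_continuous (g_sd k x).
apply: (@cvg_big _ _ _ _ _ _ _ (nbhs x)) => [|k _]; first exact: add_continuous.
apply: (continuous_max (f := fun y => h y k 0) (g := fun=> 0)).
  exact: strictly_differentiable_continuous (h_sd k x).
exact: cst_continuous.
Qed.

(* Cancelling the violation to first order: a Newton step leaves only the
   linearization error. *)
Lemma newton_step xs sigma eps : feasible_set xs -> 0 < sigma ->
  sigma <= sigma_min (constraint_jacobian xs) -> 0 < eps ->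
  exists2 r, 0 < r & forall y, eclosed_ball xs r y ->
    exists2 d, sigma * enorm d <= violation y &
      eclosed_ball xs r (y + d) ->
        violation (y + d) <= (p + q)%:R * (eps * enorm d).
Proof.
move=> [gxs hxs] sigma0 sJ eps0.
have near_g : \forall z \near (xs, xs), forall k,
    `|g z.1 k 0 - g z.2 k 0 -
      dot (gradient (fun y => g y k 0) xs) (z.1 - z.2)| <=
    eps * enorm (z.1 - z.2).
  apply: (@filter_forall _ _ _ (nbhs (xs, xs))) => k.
  exact: (strictly_differentiable_gradient (g_sd k xs)).
have near_h : \forall z \near (xs, xs), forall k,
    `|h z.1 k 0 - h z.2 k 0 -
      dot (gradient (fun y => h y k 0) xs) (z.1 - z.2)| <=
    eps * enorm (z.1 - z.2).
  apply: (@filter_forall _ _ _ (nbhs (xs, xs))) => k.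
  exact: (strictly_differentiable_gradient (h_sd k xs)).
(* Constraints inactive at [xs] stay satisfied nearby, so only active rows enter the Newton
   system. *)
have near_inactive : \forall y \near xs, forall k, h xs k 0 < 0 -> h y k 0 <= 0.
  apply: (@filter_forall _ _ _ (nbhs xs)) => k.
  have [hk|hk] := ltP (h xs k 0) 0; last by apply: (@filterE _ (nbhs xs)).
  have /(@cvgr_lt _ _ (nbhs xs)) /(_ _ hk) :=
    strictly_differentiable_continuous (h_sd k xs).
  by apply: filterS => y hy _; exact: ltW.
have [[A B] /= [xA xB] AB] := filterI near_g near_h.
have [r r0 ball_r] := eclosed_ball_nbhs (filterI (filterI xA xB) near_inactive).
exists r => // y yr.
(* Taking the positive part of the active inequalities leaves satisfied ones alone and keeps |w|
   below the violation. *)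
pose w := col_mx (g y)
  (\col_(a < #|active_set xs|) Num.max (h y (enum_val a) 0) 0).
have [d Jd d_le] := sigma_min_surjective (- w) sigma0 sJ.
have wV : enorm w <= violation y.
  apply: le_trans (enorm_le_sum w) _.
  rewrite big_split_ord /=; apply: lerD.
    by apply: ler_sum => k _; rewrite col_mxEu.
  under eq_bigr do rewrite col_mxEd mxE.
  (* The active rows are reindexed as a sum over the active set, a part of the sum over all
     inequalities. *)
  rewrite -(big_enum_val (fun k => `|Num.max (h y k 0) 0|)) /=.
  rewrite [leRHS](bigID (mem (active_set xs)))/=.
  have max0 k : 0 <= Num.max (h y k 0) 0 by rewrite le_max lexx orbT.
  under eq_bigr do rewrite ger0_norm//.
  by rewrite lerDl sumr_ge0.
exists d => [|ydr]; first by apply: le_trans d_le _; rewrite enormN.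
have [[/= _ yB] inact_y] := ball_r _ yr.
have [[/= ydA _] inact_yd] := ball_r _ ydr.
have [/= g_le h_le] := AB (y + d, y) (conj ydA yB).
have yd_y : y + d - y = d by rewrite addrC addKr.
rewrite yd_y in g_le h_le.
have g_step k : `|g (y + d) k 0| <= eps * enorm d.
  have := g_le k.
  (* Row k of J d = -w: the linear term cancels [g y k 0], so only the linearization error
     remains. *)
  have -> : dot (gradient (fun y => g y k 0) xs) d = - g y k 0.
    have /colP /(_ (lshift _ k)) := Jd; rewrite mulmx_dot rowKu rowK trmxK.
    by rewrite mxE col_mxEu.
  by rewrite opprK subrK.
have h_step k : Num.max (h (y + d) k 0) 0 <= eps * enorm d.
  have ed0 : 0 <= eps * enorm d by rewrite mulr_ge0 ?enorm_ge0// ltW.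
  rewrite ge_max ed0 andbT.
  have [hk|hk] := ltP (h xs k 0) 0; first exact: le_trans (inact_yd k hk) ed0.
  have kact : k \in active_set xs by rewrite inE eq_le hk hxs.
  have := h_le k.
  have -> : dot (gradient (fun y => h y k 0) xs) d = - Num.max (h y k 0) 0.
    have /colP /(_ (rshift _ (enum_rank_in kact k))) := Jd.
    rewrite mulmx_dot rowKd rowK trmxK enum_rankK_in//.
    by rewrite mxE col_mxEd mxE enum_rankK_in.
  (* Hence h(y + d) <= h(y) - max(h(y), 0) + eps|d| <= eps|d|. *)
  rewrite opprK => /(le_trans (ler_norm _)).
  have : h y k 0 <= Num.max (h y k 0) 0 by rewrite le_max lexx.
  lra.
have natE m (a : R) : m%:R * a = \sum_(k < m) a.
  by rewrite sumr_const card_ord mulr_natl.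
by rewrite natrD mulrDl !natE; apply: lerD; apply: ler_sum.
Qed.

(** Compactness replaces a convergent Newton iteration: one step from a minimizer of the violation
    plus [tau] times the distance to [x] must not improve it. *)
Lemma error_bound xs sigma tau r : feasible_set xs ->
  sigma <= sigma_min (constraint_jacobian xs) -> 0 < tau < sigma -> 0 < r ->
  \forall x \near xs, exists y,
    [/\ eclosed_ball xs r y, feasible_set y &
        tau * enorm (x - y) <= violation x].
Proof.
move=> xsF sJ /andP[tau0 tau_sigma] r0.
have sigma0 := lt_trans tau0 tau_sigma.
(* Makes the total linearization error (p + q)eps smaller than the gap sigma - tau; the added 1
   makes the inequality strict and the denominator positive. *)
pose eps := (sigma - tau) / (1 + (p + q)%:R).
have N0 : 0 <= (p + q)%:R :> R by rewrite ler0n.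
have N1 : 0 < 1 + (p + q)%:R :> R by lra.
have eps0 : 0 < eps by rewrite divr_gt0// subr_gt0.
have eps_small : (p + q)%:R * eps + tau < sigma.
  rewrite -ltrBrDr /eps mulrCA gtr_pMr ?subr_gt0//.
  by rewrite ltr_pdivrMr// mul1r; lra.
have [r1 r10 newton] := newton_step xsF sigma0 sJ eps0.
pose r2 := Num.min r r1.
have r20 : 0 < r2 by rewrite lt_min r0.
have r2r1 : r2 <= r1 by rewrite ge_min lexx orbT.
(* The minimizer below satisfies tau |y - x| <= V(x), and so does the Newton
   step d from it, so y + d stays in the ball of radius r2. *)
have V_small : \forall x \near xs, violation x < r2 * tau / 4.
  apply: (cvgr_lt _ (@violation_continuous xs)).
  by have /violation_eq0 -> := xsF; rewrite divr_gt0// mulr_gt0.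
have r24 : 0 < r2 / 4 by rewrite divr_gt0.
apply: filterS2 V_small (near_enorm xs r24) => x Vx xsx.
have xB : eclosed_ball xs r2 x by rewrite /eclosed_ball/=; lra.
have [|y yB ymin] := @eclosed_ball_EVT_min _ _
    (fun y => violation y + tau * enorm (y - x)) xs r2 (ltW r20).
  move=> y _; apply: (@cvgD _ _ _ (nbhs y)); first exact: violation_continuous.
  apply: (@cvgMr _ _ (nbhs y)).
  apply: (@cvg_comp _ _ _ (fun y => y - x) (@enorm R n)
                    (nbhs y) (nbhs (y - x))).
    by apply: cvgB; [exact: cvg_id|exact: cvg_cst].
  exact: enorm_continuous.
have yx : violation y + tau * enorm (y - x) <= violation x.
  by have := ymin _ xB; rewrite subrr enorm0 mulr0 addr0.
have Vy0 := violation_ge0 y.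
have yB1 : eclosed_ball xs r1 y by exact: le_trans yB r2r1.
have [d d_le d_V] := newton _ yB1.
have ydB : eclosed_ball xs r2 (y + d).
  rewrite /eclosed_ball/=.
  have -> : y + d - xs = d + (y - x) + (x - xs).
    by rewrite -[RHS]addrA subrKA addrA [y + d]addrC.
  have := enormD (d + (y - x)) (x - xs); have := enormD d (y - x).
  have : tau * enorm d < tau * (r2 / 4).
    have : tau * enorm d <= sigma * enorm d.
      by rewrite ler_wpM2r ?enorm_ge0// ltW.
    have : 0 <= tau * enorm (y - x) by rewrite mulr_ge0 ?enorm_ge0// ltW.
    lra.
  have : tau * enorm (y - x) < tau * (r2 / 4) by lra.
  rewrite !(ltr_pM2l tau0); lra.
have Vyd := d_V (le_trans ydB r2r1).
(* Minimality of y against y + d; the triangle inequality cancels [tau * enorm (y - x)]. *)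
have step : violation y <= ((p + q)%:R * eps + tau) * enorm d.
  have := ymin _ ydB; have := enormD (y - x) d; rewrite addrAC => tri min_le.
  have : tau * enorm (y + d - x) <= tau * (enorm (y - x) + enorm d).
    by rewrite ler_wpM2l// ltW.
  lra.
(* If d is nonzero, sigma|d| <= V(y) <= ((p + q)eps + tau)|d| contradicts the choice of [eps]; if d
   = 0, [step] gives V(y) <= 0. *)
have Vy : violation y = 0.
  have [d0|d0] := eqVneq (enorm d) 0.
    by apply/le_anti; rewrite Vy0 andbT; move: step; rewrite d0 mulr0.
  have dp : 0 < enorm d by rewrite lt0r d0 enorm_ge0.
  have := le_trans d_le step; rewrite ler_pM2r// leNgt eps_small//.
exists y; split; last by rewrite enorm_distrC; lra.
  by apply: le_trans yB _; rewrite ge_min lexx.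
exact/violation_eq0.
Qed.

(** * Exactness of the logarithmic penalty in the elastic problem *)

Definition elastic_feasible_set : set ('cV[R]_n * 'cV[R]_p * 'cV[R]_q) :=
  [set z : 'cV[R]_n * 'cV[R]_p * 'cV[R]_q |
           [/\ forall k, - z.1.2 k 0 <= g z.1.1 k 0 <= z.1.2 k 0,
               forall k, h z.1.1 k 0 <= z.2 k 0,
               forall k, 0 <= z.1.2 k 0 &
               forall k, 0 <= z.2 k 0]].

Lemma violation_le_slack z : elastic_feasible_set z ->
  violation z.1.1 <= \sum_k z.1.2 k 0 + \sum_k z.2 k 0.
Proof.
move=> [gz hz _ z0]; apply: lerD; apply: ler_sum => k _.
  by rewrite ler_norml.
by rewrite ge_max hz z0.
Qed.

Lemma exact_log_penalty (c : 'cV[R]_n -> R) xs (r0 sigma L rho_g rho_h : R) :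
  local_minimizer c (feasible_set) xs -> 0 < r0 -> 0 < sigma ->
  sigma <= sigma_min (constraint_jacobian xs) ->
  (forall x, eclosed_ball xs r0 x -> differentiable c x) ->
  0 < L -> (forall x, eclosed_ball xs r0 x -> enorm (gradient c x) <= L) ->
  L / sigma < Num.min rho_g rho_h ->
  local_minimizer (fun z : 'cV[R]_n * 'cV[R]_p * 'cV[R]_q => c z.1.1
    + rho_g * (\sum_k ln (1 + z.1.2 k 0)) + rho_h * (\sum_k ln (1 + z.2 k 0)))
    elastic_feasible_set (xs, 0, 0).
Proof.
move=> [xsF cmin] r00 sigma0 sJ cd L0 cL Lrho; set rho := Num.min _ _ in Lrho.
have rho0 : 0 < rho by apply: lt_trans Lrho; rewrite divr_gt0.
have Lrs : L / rho < sigma by rewrite ltr_pdivrMr// -ltr_pdivrMl// mulrC.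
(* The midpoint leaves room on both sides: tau < sigma for the error bound, and L / tau < rho for
   the penalty. *)
pose tau := (L / rho + sigma) / 2.
have [Ltau tau_sigma] : L / rho < tau /\ tau < sigma.
  by rewrite /tau; split; lra.
have tau0 : 0 < tau by apply: lt_trans Ltau; rewrite divr_gt0.
(* Below this threshold for s, rho/(1 + s) exceeds L/tau, so rho ln(1 + s) >= rho s/(1 + s) >=
   (L/tau)s. *)
have s10 : 0 < rho * tau / L - 1.
  by rewrite subr_gt0 ltr_pdivlMr// mul1r -ltr_pdivrMl// mulrC.
have ln_ge s : 0 <= s -> s < rho * tau / L - 1 ->
    L / tau * s <= rho * ln (1 + s).
  move=> s0 s1; apply: le_trans (ler_wpM2l (ltW rho0) (ln1D_ge s0)).
  have s2 : 0 < 1 + s by lra.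
  rewrite mulrA ler_pdivlMr// mulrAC ler_wpM2r//.
  rewrite mulrAC ler_pdivrMr// mulrC -ler_pdivlMr//; lra.
have [r1 r10 c_le] := eclosed_ball_nbhs cmin.
(* Within this radius the Lipschitz bound and the local minimality of [xs] both hold for the
   feasible point y. *)
pose r := Num.min r0 r1.
have rpos : 0 < r by rewrite lt_min r00.
have tau_itv : 0 < tau < sigma by rewrite tau0.
split.
  have [gxs hxs] := xsF.
  by split=> k /=; rewrite ?gxs ?mxE ?oppr0 ?lexx.
pose small m (s : 'cV[R]_m) := forall k, s k 0 < rho * tau / L - 1.
have near_small m : \forall s \near (0 : 'cV[R]_m), small m s.
  apply: filterS (near_enorm 0 s10) => s; rewrite subr0 => s_lt k.
  exact: le_lt_trans (le_trans (ler_norm _) (coord_le_enorm s k)) s_lt.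
have [U xsU near_xs] : exists2 U, nbhs xs U & forall x, U x ->
    enorm (x - xs) < r0 /\ exists y, [/\ eclosed_ball xs r y,
      feasible_set y & tau * enorm (x - y) <= violation x].
  have := @filterI _ (nbhs xs) _ _ _ (near_enorm xs r00)
    (error_bound xsF sJ tau_itv rpos).
  by move=> xsU; eexists; [exact: xsU|].
(* A product neighbourhood of (xs, 0, 0): the error bound holds in the first factor, and all slacks
   are below the threshold in the others. *)
exists (U `*` small p, small q) => /=.
  split; last exact: near_small.
  by exists (U, small p) => //=; split=> //; exact: near_small.
move=> [[x sg] sh] /= [[/near_xs [xB [y [yB yF xy]]] sg_lt] sh_lt] zF.
have := violation_le_slack zF; have [/= gz hz sg0 sh0] := zF => V_le.
have xs_y : c xs <= c y.
  by apply: c_le yF; apply: le_trans yB _; rewrite ge_min lexx orbT.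
have y_x : c y - c x <= L * enorm (y - x).
  apply: (lipschitz_eclosed_ball cd cL); last exact: ltW.
  by apply: le_trans yB _; rewrite ge_min lexx.
have V_x : L * enorm (y - x) <= L / tau * violation x.
  by rewrite enorm_distrC -mulrA ler_pM2l// ler_pdivlMl.
have pen m (s : 'cV[R]_m) rh : rho <= rh -> (forall k, 0 <= s k 0) ->
    (forall k, s k 0 < rho * tau / L - 1) ->
    L / tau * (\sum_k s k 0) <= rh * \sum_k ln (1 + s k 0).
  move=> rhoh s0 s_lt; rewrite !mulr_sumr; apply: ler_sum => k _.
  apply: le_trans (ln_ge _ (s0 k) (s_lt k)) _.
  by rewrite ler_wpM2r// ln_ge0// lerDl.
(* At (xs, 0, 0) the penalty vanishes, so the elastic cost there is [c xs]. *)
have zero m : \sum_(k < m) ln (1 + (0 : 'cV[R]_m) k 0) = 0.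
  by rewrite big1// => k _; rewrite mxE addr0 ln1.
rewrite !zero !mulr0 !addr0.
have rg : rho <= rho_g by rewrite ge_min lexx.
have rh : rho <= rho_h by rewrite ge_min lexx orbT.
have := pen _ _ _ rg sg0 sg_lt; have := pen _ _ _ rh sh0 sh_lt.
have : L / tau * violation x <= L / tau * (\sum_k sg k 0 + \sum_k sh k 0).
  by rewrite ler_wpM2l// divr_ge0// ltW.
rewrite [_ * (\sum_k sg k 0 + _)]mulrDr; lra.
Qed.

End ExactPenalty.

(** * Optimal power flow constraints *)

Section OPF.
Variables (R : realType) (nb : nat) (P : opf_data R nb).
Local Notation sd := (@strictly_differentiable R (xdim P)).

Lemma vmag_strictly_differentiable i x : sd (fun y => vmag y i) x.
Proof.
by under eq_fun do rewrite /vmag mxE; exact: strictly_differentiable_coord.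
Qed.

Lemma angle_strictly_differentiable i x : sd (fun y => angle y i) x.
Proof.
(* The second case is the slack bus, whose angle is constant. *)
rewrite /angle; case: (unlift _ _) => [j|].
  by under eq_fun do rewrite !mxE; exact: strictly_differentiable_coord.
exact: strictly_differentiable_cst.
Qed.

Lemma pgen_strictly_differentiable i x : sd (fun y => pgen y i) x.
Proof.
apply: strictly_differentiable_sum => a.
by under eq_fun do rewrite /pgen_at !mxE; exact: strictly_differentiable_coord.
Qed.

Lemma qgen_strictly_differentiable i x : sd (fun y => qgen y i) x.
Proof.
apply: strictly_differentiable_sum => a.
by under eq_fun do rewrite /qgen_at !mxE; exact: strictly_differentiable_coord.
Qed.

Lemma ptilde_strictly_differentiable b x : sd (fun y => ptilde y b) x.
Proof.
by under eq_fun do rewrite /ptilde !mxE; exact: strictly_differentiable_coord.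
Qed.

Lemma qtilde_strictly_differentiable b x : sd (fun y => qtilde y b) x.
Proof.
by under eq_fun do rewrite /qtilde !mxE; exact: strictly_differentiable_coord.
Qed.

Lemma pflow_strictly_differentiable i k x : sd (fun y => pflow y i k) x.
Proof.
have dt : sd (fun y => angle y i - angle y k) x.
  by apply: strictly_differentiableB; exact: angle_strictly_differentiable.
apply: strictly_differentiableM.
  by apply: strictly_differentiableM; exact: vmag_strictly_differentiable.
apply: strictly_differentiableD; apply: strictly_differentiableZ.
  exact: strictly_differentiable_cos.
exact: strictly_differentiable_sin.
Qed.

Lemma qflow_strictly_differentiable i k x : sd (fun y => qflow y i k) x.
Proof.
have dt : sd (fun y => angle y i - angle y k) x.
  by apply: strictly_differentiableB; exact: angle_strictly_differentiable.
apply: strictly_differentiableM.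
  by apply: strictly_differentiableM; exact: vmag_strictly_differentiable.
apply: strictly_differentiableB; apply: strictly_differentiableZ.
  exact: strictly_differentiable_sin.
exact: strictly_differentiable_cos.
Qed.

Lemma geq_strictly_differentiable k x : sd (fun y => Defs.geq y k 0) x.
Proof.
have cst (c : R) : sd (fun=> c) x by exact: strictly_differentiable_cst.
have [{}k ->|{}k ->] := split_ordP k.
  under eq_fun do rewrite col_mxEu mxE.
  apply: strictly_differentiableB; first apply: strictly_differentiableB => //.
    exact: pgen_strictly_differentiable.
  apply: strictly_differentiable_sum => l.
  exact: pflow_strictly_differentiable.
have [{}k ->|{}k ->] := split_ordP k.
  under eq_fun do rewrite col_mxEd col_mxEu mxE.
  apply: strictly_differentiableB; first apply: strictly_differentiableB => //.
    exact: qgen_strictly_differentiable.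
  apply: strictly_differentiable_sum => l.
  exact: qflow_strictly_differentiable.
have [{}k ->|{}k ->] := split_ordP k.
  under eq_fun do rewrite !col_mxEd col_mxEu mxE.
  apply: strictly_differentiableB; first exact: ptilde_strictly_differentiable.
  exact: pflow_strictly_differentiable.
under eq_fun do rewrite !col_mxEd mxE.
apply: strictly_differentiableB; first exact: qtilde_strictly_differentiable.
exact: qflow_strictly_differentiable.
Qed.

Lemma hineq_strictly_differentiable k x : sd (fun y => hineq y k 0) x.
Proof.
have cst (c : R) : sd (fun=> c) x by exact: strictly_differentiable_cst.
have dp := pgen_strictly_differentiable.
have dq := qgen_strictly_differentiable.
have dv := vmag_strictly_differentiable.
(* The first six blocks are box bounds, each a difference with a constant; the quadratic flow limits
   remain. *)
do 6! [have [{}k ->|{}k ->] := split_ordP k;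
  first by under eq_fun do rewrite ?col_mxEd col_mxEu mxE;
    apply: strictly_differentiableB].
under eq_fun do rewrite !col_mxEd mxE.
apply: strictly_differentiableB => //; apply: strictly_differentiableD;
  apply: strictly_differentiable_sqr.
  exact: ptilde_strictly_differentiable.
exact: qtilde_strictly_differentiable.
Qed.

End OPF.

(** * Exact penalty for the lifted power flow problem *)

Theorem lemma2 (R : realType) (nb : nat) (P : opf_data R nb)
  (xs : 'cV[R]_(xdim P)) (R0 sigma Lc rho_g rho_h : R)
  (hA : licq_assumption xs R0 sigma)
  (hC1 : continuously_differentiable_on (eclosed_ball xs R0) (@cost R nb P))
  (hLc0 : 0 < Lc)
  (hLc : forall x, eclosed_ball xs R0 x ->
     enorm (gradient (@cost R nb P) x) <= Lc)
  (hrho : Lc / sigma < Num.min rho_g rho_h) :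
  local_minimizer (elastic_cost rho_g rho_h) (@elastic_feasible R nb P)
    (xs, 0, 0).
Proof.
have [xs_min R00 sigma0 licq _] := hA.
apply: (exact_log_penalty (@geq_strictly_differentiable R nb P)
  (@hineq_strictly_differentiable R nb P)
  xs_min R00 sigma0 _ hC1.1 hLc0 hLc hrho).
(* The singular value bound is taken at [xs] itself, a feasible point and the centre of the ball. *)
by apply: licq; [exact: xs_min.1|rewrite /eclosed_ball/= subrr enorm0 ltW].
Qed.
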